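(* (Convergence of H-ADMM.) Assume that the set of KKT points $U^*$ is nonempty, that each $f_j$ ($j=1,\dots,n$) is strongly convex with constant $\mu_j>0$, and set $\mu=\min_{1\le j\le n}\mu_j$. Let $\rho>0$, $\gamma\in(0,2)$, let the $n=\ell p$ blocks be partitioned into $\ell$ groups of $p$ consecutive blocks, and let $P_1,\dots,P_n$ be symmetric matrices such that the associated group matrices $\mathcal{P}_1,\dots,\mathcal{P}_\ell$ satisfy $$\mathcal{P}_i\succ\frac{\rho^2}{2\mu}\|\mathcal{T}\|_2^2\,I\qquad\text{for all } i=1,\dots,\ell,$$ where $\mathcal{T}$ is the strictly upper triangular part of $A^TA$ with respect to the group partition. Then, for arbitrary $x^{(0)}\in\mathbb{R}^N$, $y^{(0)}\in\mathbb{R}^m$, the sequence $(x^{(k)},y^{(k)})_{k\ge0}$ generated by the H-ADMM algorithm converges to some element of $U^*$, i.e. to a solution of the problem of minimizing $\sum_{j=1}^n f_j(x_j)$ subject to $\sum_{j=1}^n A_jx_j=b$ (together with an associated dual solution).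
   Context: Problem: let $n\ge 2$, $N=\sum_{j=1}^n N_j$, $b\in\mathbb{R}^m$, $A_j\in\mathbb{R}^{m\times N_j}$, $A=[A_1,\dots,A_n]\in\mathbb{R}^{m\times N}$, and let $f_j:\mathbb{R}^{N_j}\to\mathbb{R}\cup\{\infty\}$ be closed convex functions. Write $x=(x_1,\dots,x_n)\in\mathbb{R}^N$ with $x_j\in\mathbb{R}^{N_j}$ and $f(x)=\sum_{j=1}^n f_j(x_j)$. The problem is to minimize $f(x)$ subject to $Ax=b$. $\partial f(x)=\{s:\ \langle s,w-x\rangle\le f(w)-f(x)\ \ \forall w\in\operatorname{dom} f\}$ is the subdifferential, with $\operatorname{dom} f=\{x: f(x)<\infty\}$ (similarly for $f_j$). The function $f_j$ is strongly convex with constant $\mu_j>0$ if $f_j(w)\ge f_j(x)+\langle s,w-x\rangle+\frac{\mu_j}{2}\|w-x\|_2^2$ for all $x,w\in\operatorname{dom} f_j$ and all $s\in\partial f_j(x)$. The set of KKT (saddle) points is $U^*=\{(x^*,y^* )\in\mathbb{R}^{N+m}:\ A^Ty^*\in\partial f(x^* ),\ Ax^*=b\}$. Groups: $n=\ell p$ with $\ell<n$; for $i=1,\dots,\ell$ let $\mathcal{S}_i=\{(i-1)p+1,\dots,ip\}$, let $\mathbf{x}_i=(x_j)_{j\in\mathcal{S}_i}$ be the stacked group vector and $\mathcal{A}_i=[A_{(i-1)p+1},\dots,A_{ip}]$, so $\mathcal{A}_i\mathbf{x}_i=\sum_{j\in\mathcal{S}_i}A_jx_j$. $\mathcal{T}\in\mathbb{R}^{N\times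 N}$ is the block matrix whose $(i,i')$ group block is $\mathcal{A}_i^T\mathcal{A}_{i'}$ if $i<i'$ and $0$ otherwise; $\|\mathcal{T}\|_2$ is its spectral norm. Given symmetric $P_j\in\mathbb{R}^{N_j\times N_j}$, $j=1,\dots,n$, the group matrix $\mathcal{P}_i$ is the block matrix indexed by $j,l\in\mathcal{S}_i$ whose diagonal blocks are $P_j$ and whose off-diagonal $(j,l)$ block ($j\ne l$) is $-\rho A_j^TA_l$. $\|z\|_M^2=z^TMz$ for symmetric positive definite $M$; $X\succ Y$ means $X-Y$ is positive definite. H-ADMM algorithm: given $x^{(0)},y^{(0)}$, for $k=0,1,2,\dots$: successively for $i=1,\dots,\ell$, set $\mathbf{b}_i=b-\sum_{q=1}^{i-1}\mathcal{A}_q\mathbf{x}_q^{(k+1)}-\sum_{s=i+1}^{\ell}\mathcal{A}_s\mathbf{x}_s^{(k)}$ and, for every $j\in\mathcal{S}_i$ (in parallel), compute $$x_j^{(k+1)}=\arg\min_{x_j}\Big\{f_j(x_j)+\frac{\rho}{2}\Big\|A_jx_j+\sum_{l\in\mathcal{S}_i,\,l\ne j}A_lx_l^{(k)}-\mathbf{b}_i-\frac{y^{(k)}}{\rho}\Big\|_2^2+\frac12\|x_j-x_j^{(k)}\|_{P_j}^2\Big\};$$ then set $y^{(k+1)}=y^{(k)}-\gamma\rho(Ax^{(k+1)}-b)$. *)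

(* Defs.v *)
From HB Require Import structures.
From mathcomp Require Import all_boot all_order all_algebra.
From mathcomp Require Import all_classical all_reals all_analysis.
Set Implicit Arguments.
Unset Strict Implicit.
Unset Printing Implicit Defensive.
Import Order.TTheory GRing.Theory Num.Theory.
Import numFieldNormedType.Exports.
Local Open Scope classical_set_scope.
Local Open Scope ring_scope.

Section Euclidean.
Variable R : realType.

(* The Euclidean structure of R^k is defined by hand: the norm that the library
   puts on matrices is the sup norm. *)
Definition dot k (u v : 'cV[R]_k) : R := (u^T *m v) 0 0.

Definition norm2 k (v : 'cV[R]_k) : R := Num.sqrt (dot v v).

(* [sqnorm M z] is ||z||_M^2. *)
Definition sqnorm k (M : 'M[R]_k) (z : 'cV[R]_k) : R := (z^T *m M *m z) 0 0.

Definition posdef k (M : 'M[R]_k) : Prop :=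
  M^T = M /\ forall z : 'cV[R]_k, z != 0 -> 0 < sqnorm M z.

Definition spectral_norm k l (M : 'M[R]_(k, l)) : R :=
  sup [set norm2 (M *m v) | v in [set v : 'cV[R]_l | norm2 v <= 1]].

End Euclidean.

Section ConvexAnalysis.
Variables (R : realType) (k : nat).
Implicit Types (f : 'cV[R]_k -> \bar R) (x w s : 'cV[R]_k).

Definition edom f : set 'cV[R]_k := [set x | (f x < +oo)%E].

Definition convex_efun f : Prop :=
  forall x w (t : R), 0 <= t <= 1 ->
    (f (t *: x + (1 - t) *: w)%R <= t%:E * f x + (1 - t)%:E * f w)%E.

(* A closed function is one whose epigraph is closed. *)
Definition closed_efun f : Prop :=
  closed [set xt : 'cV[R]_k * R | (f xt.1 <= xt.2%:E)%E].

(* Empty outside the domain, so that a function which is identically +oo has no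
   subgradients. *)
Definition subdiff f x : set 'cV[R]_k :=
  [set s | edom f x /\
    forall w, edom f w -> ((dot s (w - x))%:E <= f w - f x)%E].

Definition strongly_convex f (mu : R) : Prop :=
  forall x w s, edom f x -> edom f w -> subdiff f x s ->
    (f x + (dot s (w - x))%:E + (mu / 2 * norm2 (w - x) ^+ 2)%:E <= f w)%E.

End ConvexAnalysis.

Section Problem.
Variables (R : realType) (n m : nat) (N : 'I_n -> nat).
Variables (f : forall j, 'cV[R]_(N j) -> \bar R).
Variables (A : forall j, 'M[R]_(m, N j)) (b : 'cV[R]_m).

(* A point of R^N, N = \sum_j N j, is a single stacked column vector; its j-th
   block is [submxcol x j]. *)
Definition sep_fun (x : 'cV[R]_(\sum_j N j)) : \bar R :=
  (\sum_j f (submxcol x j))%E.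

Definition full_mx : 'M[R]_(m, \sum_j N j) := \mxrow_j A j.

Definition KKT : set ('cV[R]_(\sum_j N j) * 'cV[R]_m) :=
  [set u | subdiff sep_fun u.1 (full_mx^T *m u.2) /\ full_mx *m u.1 = b].

Definition is_solution (x : 'cV[R]_(\sum_j N j)) : Prop :=
  full_mx *m x = b /\
  forall w, full_mx *m w = b -> (sep_fun x <= sep_fun w)%E.

End Problem.

Section Groups.
Variables (R : realType) (n m p : nat) (N : 'I_n -> nat).
Variable A : forall j, 'M[R]_(m, N j).

(* Blocks and groups are numbered from 0, so group i consists of the blocks
   i * p, ..., i * p + p - 1. *)
Definition block_group (i : nat) : {set 'I_n} := [set j : 'I_n | (j %/ p)%N == i].

Definition group_mul (i : nat) (x : 'cV[R]_(\sum_j N j)) : 'cV[R]_m :=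
  \sum_(j in block_group i) A j *m submxcol x j.

(* Since groups are made of consecutive blocks, the group block (i, i') of a
   matrix gathers its blocks (j, k) with j in group i and k in group i'. *)
Definition upper_mx : 'M[R]_(\sum_j N j) :=
  \mxblock_(j, k) (if (j %/ p < k %/ p)%N then (A j)^T *m A k else 0).

(* The rows and columns of the group matrix are indexed by the blocks of
   [block_group i], enumerated in increasing order by [enum_val]. *)
Definition group_dim (i : nat) (q : 'I_#|block_group i|) : nat := N (enum_val q).

Definition group_mx (rho : R) (P : forall j, 'M[R]_(N j)) (i : nat) :
    'M[R]_(\sum_q @group_dim i q) :=
  (\mxdiag_(q < #|block_group i|) (P (enum_val q) : 'M[R]_(group_dim q))) +
  \mxblock_(q < #|block_group i|, r < #|block_group i|)
    (if q == r then 0 else - rho *: ((A (enum_val q))^T *m A (enum_val r))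
      : 'M[R]_(group_dim q, group_dim r)).

End Groups.

Section Algorithm.
Variables (R : realType) (n m l p : nat) (N : 'I_n -> nat).
Variables (f : forall j, 'cV[R]_(N j) -> \bar R).
Variables (A : forall j, 'M[R]_(m, N j)) (b : 'cV[R]_m).
Variables (rho gamma : R) (P : forall j, 'M[R]_(N j)).
Implicit Types x : 'cV[R]_(\sum_j N j).

(* The vector b_i, from the current point x and the next point x'. *)
Definition group_rhs (i : 'I_l) x x' : 'cV[R]_m :=
  b - \sum_(q < l | (q < i)%N) group_mul p A q x'
    - \sum_(s < l | (i < s)%N) group_mul p A s x.

Definition block_objective (i : 'I_l) (j : 'I_n) x x' (y : 'cV[R]_m)
    (z : 'cV[R]_(N j)) : \bar R :=
  (f z +
   (rho / 2 * norm2 (A j *m z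
      + \sum_(k in block_group n p i | k != j) A k *m submxcol x k
      - group_rhs i x x' - rho^-1 *: y) ^+ 2
    + 2^-1 * sqnorm (P j) (z - submxcol x j))%:E)%E.

Definition is_argmin (T : Type) (g : T -> \bar R) (z : T) : Prop :=
  forall w, (g z <= g w)%E.

Definition HADMM (x : nat -> 'cV[R]_(\sum_j N j)) (y : nat -> 'cV[R]_m) : Prop :=
  forall k,
    (forall (i : 'I_l) (j : 'I_n), j \in block_group n p i ->
      is_argmin (@block_objective i j (x k) (x k.+1) (y k))
        (submxcol (x k.+1) j)) /\
    y k.+1 = y k - (gamma * rho) *: (full_mx A *m x k.+1 - b).

End Algorithm.

(* Main.v *)
Require Import Defs.
From HB Require Import structures.
From mathcomp Require Import all_boot all_order all_algebra.
From mathcomp Require Import ring lra.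
From mathcomp Require Import all_classical all_reals all_analysis.
Set Implicit Arguments.
Unset Strict Implicit.
Unset Printing Implicit Defensive.
Import Order.TTheory GRing.Theory Num.Theory.
Import numFieldNormedType.Exports.
Local Open Scope classical_set_scope.
Local Open Scope ring_scope.

(** Stacking the optimality conditions of the block subproblems shows that
    [s_k = A^T (y_k - rho r) - rho T d + M d] is a subgradient of [f] at
    [x_(k+1)], where [r = A x_(k+1) - b], [d = x_k - x_(k+1)], and [M] is block
    diagonal with the group matrices on the diagonal.  With
    [e = x_(k+1) - xs], strong monotonicity against a KKT point [(xs, ys)]
    and Young's inequality for [rho <T d, e>] make
    [1/2 |x_k - xs|_M^2 + 1/(2 gamma rho) |y_k - ys|^2] decrease by at least
    [rho (1 - gamma/2) |r|^2 + 1/2 |d|_Q^2], where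
    [Q = M - rho^2/(2 mu) |T|^2 I] is positive definite.  Hence [r] and [d] tend
    to 0, and strong monotonicity forces [x_k] to tend to [xs].  Along an
    ultrafilter on the indices [y_k] converges to some [y'], and [(xs, y')] is
    again a KKT point; its Lyapunov function is monotone and tends to 0 along the
    ultrafilter, hence tends to 0, which gives convergence of the whole
    sequence. *)

(** * Euclidean algebra *)

Section EuclideanAlgebra.
Context {R : realType}.
Implicit Types k l : nat.

Lemma dotE k (u v : 'cV[R]_k) : dot u v = \sum_i u i 0 * v i 0.
Proof. by rewrite /dot mxE; apply: eq_bigr => i _; rewrite mxE. Qed.

Lemma dotC k (u v : 'cV[R]_k) : dot u v = dot v u.
Proof. by rewrite !dotE; apply: eq_bigr => i _; rewrite mulrC. Qed.

Lemma dotDr k (u v w : 'cV[R]_k) : dot u (v + w) = dot u v + dot u w.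
Proof. by rewrite /dot mulmxDr mxE. Qed.

Lemma dotDl k (u v w : 'cV[R]_k) : dot (u + v) w = dot u w + dot v w.
Proof. by rewrite dotC dotDr !(dotC w). Qed.

Lemma dotZr k a (u v : 'cV[R]_k) : dot u (a *: v) = a * dot u v.
Proof. by rewrite /dot -scalemxAr mxE. Qed.

Lemma dotZl k a (u v : 'cV[R]_k) : dot (a *: u) v = a * dot u v.
Proof. by rewrite dotC dotZr dotC. Qed.

Lemma dotNr k (u v : 'cV[R]_k) : dot u (- v) = - dot u v.
Proof. by rewrite -scaleN1r dotZr mulN1r. Qed.

Lemma dotNl k (u v : 'cV[R]_k) : dot (- u) v = - dot u v.
Proof. by rewrite dotC dotNr dotC. Qed.

Lemma dot0r k (u : 'cV[R]_k) : dot u 0 = 0.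
Proof. by rewrite /dot mulmx0 mxE. Qed.

Lemma dot_sumr k (I : finType) (Q : pred I) (u : 'cV[R]_k) (v : I -> 'cV[R]_k) :
  dot u (\sum_(i | Q i) v i) = \sum_(i | Q i) dot u (v i).
Proof. by rewrite /dot mulmx_sumr summxE. Qed.

Lemma dot_mulmxl k l (M : 'M[R]_(k, l)) u v :
  dot (M *m u) v = dot u (M^T *m v).
Proof. by rewrite /dot trmx_mul mulmxA. Qed.

Lemma dot_mulmxr k l (M : 'M[R]_(k, l)) u v :
  dot u (M *m v) = dot (M^T *m u) v.
Proof. by rewrite dot_mulmxl trmxK. Qed.

Lemma dot_ge0 k (u : 'cV[R]_k) : 0 <= dot u u.
Proof. by rewrite dotE sumr_ge0 // => i _; rewrite -expr2 sqr_ge0. Qed.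

Lemma dot_eq0 k (u : 'cV[R]_k) : dot u u = 0 -> u = 0.
Proof.
rewrite dotE => /eqP; rewrite psumr_eq0; last first.
  by move=> i _; rewrite -expr2 sqr_ge0.
move=> /allP u0; apply/colP => i; rewrite mxE.
by have /eqP := u0 i (mem_index_enum i); move/eqP; rewrite /= mulf_eq0 orbb => /eqP.
Qed.

Lemma sqr_norm2 k (u : 'cV[R]_k) : norm2 u ^+ 2 = dot u u.
Proof. by rewrite /norm2 sqr_sqrtr // dot_ge0. Qed.

Lemma sqnormE k (M : 'M[R]_k) z : sqnorm M z = dot z (M *m z).
Proof. by rewrite /sqnorm /dot mulmxA. Qed.

Lemma sqnorm_scalar k (c : R) (z : 'cV[R]_k) : sqnorm c%:M z = c * dot z z.
Proof. by rewrite sqnormE mul_scalar_mx dotZr. Qed.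

Lemma sqnormB k (M M' : 'M[R]_k) z : sqnorm (M - M') z = sqnorm M z - sqnorm M' z.
Proof. by rewrite !sqnormE mulmxBl dotDr dotNr. Qed.

Lemma dot_mxcol n (N : 'I_n -> nat) (u v : 'cV[R]_(\sum_j N j)) :
  dot u v = \sum_j dot (submxcol u j) (submxcol v j).
Proof.
by rewrite /dot -{1}(submxcolK u) -{1}(submxcolK v) tr_mxcol mul_mxrow_mxcol summxE.
Qed.

Lemma sqnorm_ge0 k (M : 'M[R]_k) z : posdef M -> 0 <= sqnorm M z.
Proof.
move=> [_ Mpos]; have [->|z0] := eqVneq z 0; last exact/ltW/Mpos.
by rewrite sqnormE mulmx0 dot0r.
Qed.

(** The [M]-norm of [u - t *: v] is nonnegative for every [t]; the [t] chosen here minimizes it. *)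
Lemma posdef_cauchy_schwarz k (M : 'M[R]_k) (u v : 'cV[R]_k) : posdef M ->
  dot u (M *m v) ^+ 2 <= sqnorm M u * sqnorm M v.
Proof.
move=> Mpd; have [->|v0] := eqVneq v 0.
  by rewrite !sqnormE !mulmx0 !dot0r expr0n mulr0.
have [Msym Mpos] := Mpd; have vv := Mpos v v0.
set t := dot u (M *m v) / sqnorm M v.
have := sqnorm_ge0 (u - t *: v) Mpd.
rewrite !sqnormE mulmxBr -scalemxAr !(dotDl, dotDr, dotNl, dotNr, dotZl, dotZr).
rewrite (_ : dot v (M *m u) = dot u (M *m v)); last first.
  by rewrite dot_mulmxr Msym dotC.
rewrite -!sqnormE => H.
have tE : t * sqnorm M v = dot u (M *m v) by rewrite /t divfK // gt_eqF.
rewrite -tE; rewrite -tE in H.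
by have := mulr_ge0 (ltW vv) H; lra.
Qed.

Lemma posdef_unitmx k (M : 'M[R]_k) : posdef M -> M \in unitmx.
Proof.
move=> [Msym Mpos]; rewrite -row_free_unit; apply: inj_row_free => v vM.
apply/eqP/negPn/negP => v0.
have vT0 : v^T != 0 by rewrite trmx_eq0.
by have := Mpos _ vT0; rewrite /sqnorm trmxK vM mul0mx mxE ltxx.
Qed.

(* Coercivity without compactness: [d i 0] is the [M]-inner product of [d] with
   [M^-1 e_i]. *)
Lemma posdef_entry_bound k (M : 'M[R]_k) : posdef M ->
  exists C : R, forall (d : 'cV[R]_k) i, d i 0 ^+ 2 <= C * sqnorm M d.
Proof.
move=> Mpd; have Mu := posdef_unitmx Mpd.
pose v i : 'cV[R]_k := invmx M *m delta_mx i 0.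
exists (\sum_i sqnorm M (v i)) => d i.
have -> : d i 0 = dot (v i) (M *m d).
  rewrite dot_mulmxr Mpd.1 mulmxA mulmxV // mul1mx dotE (bigD1 i) //= mxE !eqxx.
  rewrite mul1r big1 ?addr0 // => j /negPf ji.
  by rewrite mxE ji mul0r.
apply: le_trans (posdef_cauchy_schwarz _ _ Mpd) _.
rewrite ler_wpM2r ?sqnorm_ge0 // (bigD1 i) //= lerDl sumr_ge0 // => j _.
exact: sqnorm_ge0.
Qed.

Lemma dot_cauchy_schwarz k (u v : 'cV[R]_k) : dot u v ^+ 2 <= dot u u * dot v v.
Proof.
have Ipd : posdef (1%:M : 'M[R]_k).
  split=> [|z z0]; first exact: trmx1.
  rewrite sqnorm_scalar mul1r lt_def dot_ge0 andbT.
  by apply: contraNneq z0 => /dot_eq0 ->.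
by have := posdef_cauchy_schwarz u v Ipd; rewrite !sqnorm_scalar mul1mx !mul1r.
Qed.

(** Rescaling [v] to unit length turns the bound into membership in the set whose supremum is
    taken. *)
Lemma spectral_norm_bound k l (M : 'M[R]_(k, l)) v :
  dot (M *m v) (M *m v) <= spectral_norm M ^+ 2 * dot v v.
Proof.
have [->|v0] := eqVneq v 0; first by rewrite mulmx0 !dot0r mulr0.
have v2 : 0 < dot v v.
  by rewrite lt_def dot_ge0 andbT; apply: contraNneq v0 => /dot_eq0 ->.
have nv : 0 < norm2 v by rewrite sqrtr_gt0.
set S := [set norm2 (M *m v) | v in [set v : 'cV[R]_l | norm2 v <= 1]].
(* A [sup] is an upper bound only for a set that is bounded above. Cauchy-Schwarz on each row of [M]
   gives the Frobenius norm as a bound. *)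
have Sub : has_ubound S.
  exists (Num.sqrt (\sum_i dot (row i M)^T (row i M)^T)) => _ [w /= w1 <-].
  rewrite ler_wsqrtr // dotE; apply: ler_sum => i _.
  have -> : (M *m w) i 0 = dot (row i M)^T w.
    by rewrite dotE mxE; apply: eq_bigr => j _; rewrite !mxE.
  rewrite -expr2; apply: le_trans (dot_cauchy_schwarz _ _) _.
  rewrite -[leRHS]mulr1 ler_wpM2l ?dot_ge0 // -sqr_norm2 expr_le1 //.
  exact: sqrtr_ge0.
have : norm2 (M *m ((norm2 v)^-1 *: v)) <= spectral_norm M.
  apply: ub_le_sup => //; exists ((norm2 v)^-1 *: v) => //=.
  rewrite /norm2 dotZl dotZr mulrA -expr2 -/(norm2 v).
  by rewrite -(sqr_norm2 v) exprVn mulVf ?sqrtr1 // expf_neq0 // gt_eqF.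
move=> H.
have : norm2 (M *m ((norm2 v)^-1 *: v)) ^+ 2 <= spectral_norm M ^+ 2.
  by rewrite ler_sqr ?nnegrE ?sqrtr_ge0 //; apply: le_trans H; exact: sqrtr_ge0.
rewrite sqr_norm2 -scalemxAr dotZl dotZr mulrA -expr2 exprVn sqr_norm2 mulrC.
by rewrite ler_pdivrMr.
Qed.

End EuclideanAlgebra.

(** * Subgradients and the Lyapunov function *)

Section Subdifferential.
Context {R : realType} {k : nat}.
Variable F : 'cV[R]_k -> \bar R.
Hypothesis F_gtNy : forall x, (-oo < F x)%E.
Implicit Types x w s : 'cV[R]_k.

Lemma edom_fineK x : edom F x -> (fine (F x))%:E = F x.
Proof. by rewrite /edom /= => Fx; rewrite fineK // fin_numElt F_gtNy Fx. Qed.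

Lemma subdiffP x s : subdiff F x s <->
  edom F x /\ forall w, edom F w -> fine (F x) + dot s (w - x) <= fine (F w).
Proof.
split=> -[Fx sub]; split=> // w Fw.
  have := sub w Fw.
  by rewrite -edom_fineK // -(edom_fineK Fx) -EFinB lee_fin lerBrDl.
rewrite -edom_fineK // -(edom_fineK Fx) -EFinB lee_fin lerBrDl.
exact: sub.
Qed.

Lemma strongly_convex_le mu : strongly_convex F mu ->
  forall x w s, edom F w -> subdiff F x s ->
  fine (F x) + dot s (w - x) + mu / 2 * dot (w - x) (w - x) <= fine (F w).
Proof.
move=> sc x w s Fw sub; have Fx := sub.1.
have := sc x w s Fx Fw sub; rewrite sqr_norm2.
by rewrite -(edom_fineK Fw) -(edom_fineK Fx) -!EFinD lee_fin.
Qed.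

(** The strong convexity inequalities based at [x] and at [w] are added: the function values cancel
    and the two terms in [mu / 2] combine. *)
Lemma strongly_monotone mu : strongly_convex F mu ->
  forall x w s t, subdiff F x s -> subdiff F w t ->
  mu * dot (x - w) (x - w) <= dot (s - t) (x - w).
Proof.
move=> sc x w s t xs wt.
have := strongly_convex_le sc wt.1 xs; have := strongly_convex_le sc xs.1 wt.
rewrite -(opprB x w) !(dotDl, dotNl, dotNr) opprK => H1 H2.
by lra.
Qed.

End Subdifferential.

(** * One-step decrease of the Lyapunov function *)

Section Lyapunov.
Context {R : realType} {k m : nat}.
Variables (A : 'M[R]_(m, k)) (T M : 'M[R]_k) (rho gamma mu sigma2 : R).
Hypotheses (rho_gt0 : 0 < rho) (gamma_gt0 : 0 < gamma) (mu_gt0 : 0 < mu).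
Hypothesis M_sym : M^T = M.
Hypothesis T_bound : forall v, dot (T *m v) (T *m v) <= sigma2 * dot v v.

(** [e] and [h] are the primal and dual errors. The dual weight is tuned so that the cross term in
    [dot h (A *m e)] created by the dual update cancels the one coming from monotonicity. *)
Definition lyapunov (e : 'cV[R]_k) (h : 'cV[R]_m) : R :=
  2^-1 * sqnorm M e + (2 * (gamma * rho))^-1 * dot h h.

(** Here [e] is the primal error after the step and [d] the old iterate minus the new one, so
    [d + e] and [h] are the errors before the step. The unsigned term [rho * dot (T *m d) e] is
    absorbed by [mu * dot e e], at the price of the multiple of the identity subtracted from [M]. *)
Lemma lyapunov_decrease (e d : 'cV[R]_k) (h : 'cV[R]_m) :
  mu * dot e e <=
    dot (A^T *m (h - rho *: (A *m e)) - rho *: (T *m d) + M *m d) e ->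
  lyapunov e (h - (gamma * rho) *: (A *m e))
    + rho * (1 - gamma / 2) * dot (A *m e) (A *m e)
    + 2^-1 * sqnorm (M - (rho ^+ 2 / (2 * mu) * sigma2)%:M) d
  <= lyapunov (d + e) h.
Proof.
set kappa := rho ^+ 2 / (2 * mu) => mono.
have mu_neq0 := lt0r_neq0 mu_gt0.
have kappa_mu : mu * kappa = rho ^+ 2 / 2 by rewrite /kappa; field.
have kappa_gt0 : 0 < kappa by rewrite /kappa divr_gt0 ?mulr_gt0 ?exprn_gt0.
have young : 0 <= kappa / 2 * dot (T *m d) (T *m d)
                  + rho * dot (T *m d) e + mu * dot e e.
  (* Multiplied by [mu], the expression is the squared norm of [(rho / 2) *: (T *m d) + mu *: e],
     which avoids the square root of [mu]. *)
  rewrite -(pmulr_rge0 _ mu_gt0).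
  have := dot_ge0 ((rho / 2) *: (T *m d) + mu *: e).
  rewrite !(dotDl, dotDr, dotZl, dotZr) (dotC e).
  set t := dot (T *m d) (T *m d); set u := dot (T *m d) e; set w := dot e e => sq.
  have -> : mu * (kappa / 2 * t + rho * u + mu * w) =
      mu * kappa / 2 * t + mu * rho * u + mu * mu * w by ring.
  by rewrite kappa_mu; lra.
have Td := ler_wpM2l (ltW kappa_gt0) (T_bound d).
move: mono; rewrite /lyapunov sqnormB sqnorm_scalar !sqnormE (mulmxDr M).
rewrite !(dotDl, dotDr, dotNl, dotNr, dotZl, dotZr, dot_mulmxl A^T) trmxK.
have -> : dot d (M *m e) = dot (M *m d) e by rewrite dot_mulmxr M_sym.
rewrite (dotC e (M *m d)) (dotC (A *m e) h) => mono.
(* The inverse enters only through the product [c * v], equal to 1/2; once this is substituted,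
   [lra] can conclude. *)
have [c0 cV] : gamma * rho != 0 /\ gamma * rho * (2 * (gamma * rho))^-1 = 2^-1.
  by split; [rewrite mulf_neq0 ?gt_eqF|field; rewrite !gt_eqF].
set c := gamma * rho in c0 cV *; set v := (2 * c)^-1 in cV *.
have -> : v * (dot h h - c * dot h (A *m e)
      + (- (c * dot h (A *m e)) - (c * - (c * dot (A *m e) (A *m e))))) =
    v * dot h h - 2 * (c * v) * dot h (A *m e) + c * (c * v) * dot (A *m e) (A *m e).
  by ring.
rewrite cV /c.
by lra.
Qed.

End Lyapunov.

(** * Entrywise limits *)

Section EntrywiseConvergence.
Context {R : realType} {I : Type} {U : set_system I} {FU : ProperFilter U}.

(** Stated for a general filter [U], so that the same rules serve [\oo] and an ultrafilter;
    coordinates reduce inner and matrix products to finite sums of real limits. *)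
Definition entry_cvg k (v : I -> 'cV[R]_k) (l : 'cV[R]_k) :=
  forall i, v t i 0 @[t --> U] --> l i 0.

Lemma entry_cvg_cst k (v : 'cV[R]_k) : entry_cvg (fun=> v) v.
Proof. by move=> i; apply: cvg_cst. Qed.

Lemma entry_cvgD k (u v : I -> 'cV[R]_k) a b :
  entry_cvg u a -> entry_cvg v b -> entry_cvg (fun t => u t + v t) (a + b).
Proof.
move=> ua vb i; rewrite mxE; under eq_cvg do rewrite mxE.
by apply: cvgD; [exact: ua|exact: vb].
Qed.

Lemma entry_cvgZ k c (u : I -> 'cV[R]_k) a :
  entry_cvg u a -> entry_cvg (fun t => c *: u t) (c *: a).
Proof.
move=> ua i; rewrite mxE; under eq_cvg do rewrite mxE.
by apply: cvgM; [exact: cvg_cst|exact: ua].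
Qed.

Lemma entry_cvgB k (u v : I -> 'cV[R]_k) a b :
  entry_cvg u a -> entry_cvg v b -> entry_cvg (fun t => u t - v t) (a - b).
Proof.
move=> ua vb i; rewrite !mxE; under eq_cvg do rewrite !mxE.
by apply: cvgB; [exact: ua|exact: vb].
Qed.

Lemma entry_cvg_subK k (u : I -> 'cV[R]_k) a b :
  entry_cvg (fun t => u t - a) b -> entry_cvg u (b + a).
Proof.
move=> ua; rewrite (_ : u = fun t => u t - a + a); last first.
  by apply/funext => t; rewrite subrK.
by apply: entry_cvgD => //; exact: entry_cvg_cst.
Qed.

Lemma cvg_dot k (u v : I -> 'cV[R]_k) a b :
  entry_cvg u a -> entry_cvg v b -> dot (u t) (v t) @[t --> U] --> dot a b.
Proof.
move=> ua vb; rewrite dotE; under eq_cvg do rewrite dotE.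
apply: cvg_big => [|i _]; first exact: add_continuous.
by apply: cvgM; [exact: ua|exact: vb].
Qed.

Lemma entry_cvg_mulmx k l (M : 'M[R]_(l, k)) (u : I -> 'cV[R]_k) a :
  entry_cvg u a -> entry_cvg (fun t => M *m u t) (M *m a).
Proof.
move=> ua i; rewrite mxE; under eq_cvg do rewrite mxE.
apply: cvg_big => [|j _]; first exact: add_continuous.
by apply: cvgM; [exact: cvg_cst|exact: ua].
Qed.

(** Balls of matrices are entrywise balls, and a filter is stable under the finite intersection over
    the entries. *)
Lemma entry_cvg_cvg k (v : I -> 'cV[R]_k) (l : 'cV[R]_k) :
  entry_cvg v l -> v t @[t --> U] --> l.
Proof.
move=> vl; apply/cvg_ballP => e e0.
have : \forall t \near U, forall ij : 'I_k * 'I_1, ball (l ij.1 ij.2) e (v t ij.1 ij.2).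
  apply: filter_forall => -[i j] /=; rewrite (ord1 j).
  exact: (cvg_ball (vl i)).
by apply: filterS => t vt; split=> // i j; exact: (vt (i, j)).
Qed.

Lemma cvg0_of_sqr_le (g q : I -> R) (C : R) : (forall t, g t ^+ 2 <= C * q t) ->
  q t @[t --> U] --> 0 -> g t @[t --> U] --> 0.
Proof.
move=> gq q0; apply/cvgr0Pnorm_lt => e e0.
have : C * q t @[t --> U] --> 0 by rewrite -(mulr0 C); apply: cvgM; [exact: cvg_cst|].
have e2 : 0 < e ^+ 2 by rewrite exprn_gt0.
move/cvgr0Pnorm_lt => /(_ _ e2); apply: filterS => t Ct.
rewrite -(@ltr_pXn2r _ 2) ?nnegrE ?normr_ge0 ?(ltW e0) // real_normK ?num_real //.
by apply: le_lt_trans (gq t) _; apply: le_lt_trans Ct; exact: ler_norm.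
Qed.

End EntrywiseConvergence.
Arguments entry_cvg {R I} U {k} v l.
Arguments entry_cvg_cst {R I U FU k} v _.

(** * Limits of bounded families along an ultrafilter *)

Section UltrafilterLimits.
Context {R : realType} {I : Type} {U : set_system I} {UU : UltraFilter U}.

(** Compactness of a segment gives a cluster point [l]. It is a limit: if the preimage of a
    neighbourhood of [l] were not in [U], its complement would be, contradicting clustering at
    [l]. *)
Lemma ultra_bounded_cvg (g : I -> R) (C : R) : (forall t, g t ^+ 2 <= C) ->
  exists l : R, g t @[t --> U] --> l.
Proof.
move=> gC; have UP : ProperFilter U by exact: ultra_proper.
(* The squares of [g t - 1] and [g t + 1] give the bound [1 + C] without a square root of [C]. *)
have gI t : `[- (1 + C), 1 + C]%classic (g t).
  have := gC t; have := sqr_ge0 (g t - 1); have := sqr_ge0 (g t + 1).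
  by rewrite /= in_itv /= => *; apply/andP; split; nra.
have [l [_ cl]] := segment_compact (fmap_proper_filter g UP)
  (filterS (fun t _ => gI t) filterT).
exists l => B Bl; have [//|nB] := in_ultra_setVsetC (g @^-1` B) UU.
by have [z [nBz Bz]] := cl (~` B) B nB Bl; case: nBz.
Qed.

Lemma ultra_entry_cvg k (v : I -> 'cV[R]_k) (C : R) :
  (forall t i, v t i 0 ^+ 2 <= C) -> exists l, entry_cvg U v l.
Proof.
move=> vC.
have /choice [l vl] i : exists l : R, v t i 0 @[t --> U] --> l.
  by apply: (@ultra_bounded_cvg _ C).
by exists (\col_i l i) => i; rewrite mxE; exact: vl.
Qed.

End UltrafilterLimits.

(** * Convergence of the iterates *)

Section AbstractConvergence.
Context {R : realType} {k m : nat}.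
Variables (F : 'cV[R]_k -> \bar R) (A : 'M[R]_(m, k)) (b : 'cV[R]_m).
Variables (T M : 'M[R]_k) (rho gamma mu sigma2 : R).
Variables (x : nat -> 'cV[R]_k) (y : nat -> 'cV[R]_m).
Hypothesis F_gtNy : forall z, (-oo < F z)%E.
Hypothesis F_sc : strongly_convex F mu.
Hypotheses (rho_gt0 : 0 < rho) (gamma_gt0 : 0 < gamma) (gamma_lt2 : gamma < 2).
Hypotheses (mu_gt0 : 0 < mu) (sigma2_ge0 : 0 <= sigma2).
Hypothesis T_bound : forall v, dot (T *m v) (T *m v) <= sigma2 * dot v v.
Let Q : 'M[R]_k := M - (rho ^+ 2 / (2 * mu) * sigma2)%:M.
Hypothesis Q_posdef : posdef Q.

Let s n : 'cV[R]_k := A^T *m (y n - rho *: (A *m x n.+1 - b))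
  - rho *: (T *m (x n - x n.+1)) + M *m (x n - x n.+1).
Hypothesis x_step : forall n, subdiff F (x n.+1) (s n).
Hypothesis y_step : forall n, y n.+1 = y n - (gamma * rho) *: (A *m x n.+1 - b).

Lemma proximal_posdef : posdef M.
Proof.
have [Qsym Qpos] := Q_posdef.
have ME : M = Q + (rho ^+ 2 / (2 * mu) * sigma2)%:M by rewrite subrK.
split; first by rewrite ME linearD /= Qsym tr_scalar_mx.
move=> z z0; apply: lt_le_trans (Qpos z z0) _.
rewrite sqnormB sqnorm_scalar gerBl mulr_ge0 ?dot_ge0 //.
by rewrite mulr_ge0 // divr_ge0 ?exprn_ge0 ?mulr_ge0 ?ltW.
Qed.

Let V xs ys n := lyapunov M rho gamma (x n - xs) (y n - ys).

(** * Descent relative to a fixed KKT point *)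

Section AtKKTPoint.
Variables (xs : 'cV[R]_k) (ys : 'cV[R]_m).
Hypotheses (sub_xs : subdiff F xs (A^T *m ys)) (Axs : A *m xs = b).

Let errE n : A *m x n.+1 - b = A *m (x n.+1 - xs).
Proof. by rewrite mulmxBr Axs. Qed.

(** Strong monotonicity between [x n.+1] and [xs], with the difference of the subgradients rewritten
    in terms of errors to match the premise of [lyapunov_decrease]. *)
Lemma iterate_monotone n :
  mu * dot (x n.+1 - xs) (x n.+1 - xs) <=
  dot (A^T *m ((y n - ys) - rho *: (A *m (x n.+1 - xs)))
       - rho *: (T *m (x n - x n.+1)) + M *m (x n - x n.+1)) (x n.+1 - xs).
Proof.
have := strongly_monotone F_gtNy F_sc (x_step n) sub_xs.
suff -> : s n - A^T *m ys =
    A^T *m ((y n - ys) - rho *: (A *m (x n.+1 - xs)))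
    - rho *: (T *m (x n - x n.+1)) + M *m (x n - x n.+1) by [].
rewrite /s errE addrAC; congr (_ + _); rewrite addrAC; congr (_ + _).
by rewrite -mulmxBr; congr (_ *m _); rewrite addrAC.
Qed.

Lemma lyapunov_iterates_descent n :
  V xs ys n.+1 + rho * (1 - gamma / 2) * dot (A *m (x n.+1 - xs)) (A *m (x n.+1 - xs))
  + 2^-1 * sqnorm Q (x n - x n.+1) <= V xs ys n.
Proof.
have := lyapunov_decrease rho_gt0 gamma_gt0 mu_gt0 proximal_posdef.1 T_bound
  (iterate_monotone n).
rewrite addrA subrK /V; congr (lyapunov _ _ _ _ _ + _ + _ <= _).
by rewrite y_step errE addrAC.
Qed.

Lemma lyapunov_iterates_ge0 n : 0 <= V xs ys n.
Proof.
rewrite addr_ge0 // mulr_ge0 ?invr_ge0 ?dot_ge0 ?ler0n //.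
  exact: sqnorm_ge0 proximal_posdef.
by rewrite !mulr_ge0 ?ltW.
Qed.

(** Both dissipation terms are nonnegative, the first because [gamma < 2], so each is controlled
    separately by the drop of [V]. *)
Lemma lyapunov_iterates_decrease n : [/\ V xs ys n.+1 <= V xs ys n,
    rho * (1 - gamma / 2) * dot (A *m (x n.+1 - xs)) (A *m (x n.+1 - xs))
      <= V xs ys n - V xs ys n.+1 &
    2^-1 * sqnorm Q (x n - x n.+1) <= V xs ys n - V xs ys n.+1].
Proof.
have H := lyapunov_iterates_descent n.
have H1 : 0 <= rho * (1 - gamma / 2) * dot (A *m (x n.+1 - xs)) (A *m (x n.+1 - xs)).
  by rewrite !mulr_ge0 ?dot_ge0 ?(ltW rho_gt0) //; move: gamma_lt2; lra.
have H2 := sqnorm_ge0 (x n - x n.+1) Q_posdef.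
by split; lra.
Qed.

Lemma lyapunov_iterates_nonincreasing : nonincreasing_seq (V xs ys).
Proof. by apply/nonincreasing_seqP => n; have [] := lyapunov_iterates_decrease n. Qed.

Lemma lyapunov_iterates_is_cvg : cvgn (V xs ys).
Proof.
apply: nonincreasing_is_cvgn lyapunov_iterates_nonincreasing _.
by exists 0 => _ [n _ <-]; exact: lyapunov_iterates_ge0.
Qed.

Lemma lyapunov_iterates_diff_cvg0 : V xs ys n - V xs ys n.+1 @[n --> \oo] --> 0.
Proof.
rewrite -(subrr (limn (V xs ys))); apply: cvgB; first exact: lyapunov_iterates_is_cvg.
by have := lyapunov_iterates_is_cvg; rewrite -cvg_shiftS.
Qed.

Lemma residual_cvg0 : entry_cvg \oo (fun n => A *m (x n.+1 - xs)) 0.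
Proof.
have c0 : 0 < rho * (1 - gamma / 2) by rewrite mulr_gt0 //; move: gamma_lt2; lra.
move=> i; rewrite mxE.
apply: (cvg0_of_sqr_le (C := (rho * (1 - gamma / 2))^-1)) lyapunov_iterates_diff_cvg0 => n.
rewrite mulrC ler_pdivlMr //.
have [_ H _] := lyapunov_iterates_decrease n; apply: le_trans H; rewrite mulrC ler_pM2l //.
rewrite dotE (bigD1 i) //= -expr2 lerDl sumr_ge0 // => j _.
by rewrite -expr2 sqr_ge0.
Qed.

Lemma step_cvg0 : entry_cvg \oo (fun n => x n - x n.+1) 0.
Proof.
have [C HC] := posdef_entry_bound Q_posdef.
move=> i; rewrite mxE.
(* [C] comes without a sign, hence the absolute value; the factor 2 undoes the 1/2 in front of
   [sqnorm Q]. *)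
apply: (cvg0_of_sqr_le (C := 2 * `|C|)) lyapunov_iterates_diff_cvg0 => n.
apply: le_trans (HC _ _) _; have [_ _ H] := lyapunov_iterates_decrease n.
have H2 := sqnorm_ge0 (x n - x n.+1) Q_posdef.
apply: le_trans (ler_wpM2r H2 (ler_norm C)) _.
have := ler_wpM2l (normr_ge0 C) H; lra.
Qed.

Lemma iterates_entry_bound : exists C : R, forall n,
  (forall i, (x n - xs) i 0 ^+ 2 <= C * V xs ys n) /\
  (forall i, (y n - ys) i 0 ^+ 2 <= C * V xs ys n).
Proof.
have [C HC] := posdef_entry_bound proximal_posdef.
have c0 : 0 < 2 * (gamma * rho) by rewrite !mulr_gt0.
(* The first summand serves the primal entries and the second the dual ones. *)
exists (2 * `|C| + 2 * (gamma * rho)) => n.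
have sx := sqnorm_ge0 (x n - xs) proximal_posdef.
have sy : 0 <= (2 * (gamma * rho))^-1 * dot (y n - ys) (y n - ys).
  by rewrite mulr_ge0 ?dot_ge0 // invr_ge0 ltW.
have C0 := normr_ge0 C.
have VE : V xs ys n = 2^-1 * sqnorm M (x n - xs)
   + (2 * (gamma * rho))^-1 * dot (y n - ys) (y n - ys) by [].
split=> i.
  apply: le_trans (HC _ _) _; apply: le_trans (ler_wpM2r sx (ler_norm C)) _.
  rewrite VE mulrDl; apply: ler_wpDr; first by rewrite mulr_ge0 ?(ltW c0) // -VE
    lyapunov_iterates_ge0.
  by have := mulr_ge0 C0 sy; lra.
apply: (@le_trans _ _ (dot (y n - ys) (y n - ys))).
  rewrite dotE (bigD1 i) //= -expr2 lerDl sumr_ge0 // => j _.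
  by rewrite -expr2 sqr_ge0.
rewrite mulrDl; apply: ler_wpDl; first by rewrite !mulr_ge0 // lyapunov_iterates_ge0.
rewrite VE mulrDr mulVKf ?gt_eqF // lerDr.
by rewrite !mulr_ge0 // ltW.
Qed.

Lemma lyapunov_cvg0_iterates_cvg :
  V xs ys @ \oo --> (0 : R) -> entry_cvg \oo x xs /\ entry_cvg \oo y ys.
Proof.
have [C HC] := iterates_entry_bound => V0.
by split; rewrite -[X in entry_cvg _ _ X]add0r; apply: entry_cvg_subK => i; rewrite mxE;
  apply: (cvg0_of_sqr_le (C := C)) V0 => n; have [? ?] := HC n.
Qed.

(** * Limits of the iterates along an ultrafilter finer than [\oo] *)

Section AlongUltrafilter.
Context {U : set_system nat} {UU : UltraFilter U}.
Hypothesis U_oo : \oo `<=` U.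

Lemma iterates_entry_ubound : exists C : R, forall n,
  (forall i, (x n - xs) i 0 ^+ 2 <= C) /\ (forall i, (y n - ys) i 0 ^+ 2 <= C).
Proof.
have [C HC] := iterates_entry_bound; exists (`|C| * V xs ys 0%N) => n.
have Vn : C * V xs ys n <= `|C| * V xs ys 0%N.
  apply: le_trans (ler_wpM2r (lyapunov_iterates_ge0 n) (ler_norm C)) _.
  by rewrite ler_wpM2l // lyapunov_iterates_nonincreasing.
by split=> i; apply: le_trans Vn; have [? ?] := HC n.
Qed.

Lemma dual_ultra_cvg : exists yi, entry_cvg U y yi.
Proof.
have UP : ProperFilter U by exact: ultra_proper.
have [C HC] := iterates_entry_ubound.
have [h hP] : exists h, entry_cvg U (fun n => y n - ys) h.
  by apply: (ultra_entry_cvg (C := C)) => n i; have [_] := HC n.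
by exists (h + ys); exact: entry_cvg_subK.
Qed.

(** Boundedness gives some limit [e] of the error. In the limit, strong monotonicity reads
    [mu * dot e e <= 0], since the residual and the step vanish while the factors paired with them
    converge. *)
Lemma primal_ultra_cvg : entry_cvg U (fun n => x n.+1) xs.
Proof.
have UP : ProperFilter U by exact: ultra_proper.
have [C HC] := iterates_entry_ubound.
have [e eP] : exists e, entry_cvg U (fun n => x n.+1 - xs) e.
  by apply: (ultra_entry_cvg (C := C)) => n i; have [] := HC n.+1.
have [yi yiP] := dual_ultra_cvg.
have dP : entry_cvg U (fun n => x n - x n.+1) 0.
  by move=> i; apply: cvg_trans (step_cvg0 (i := i)); apply: cvg_app.
have rP : entry_cvg U (fun n => A *m (x n.+1 - xs)) 0.
  by move=> i; apply: cvg_trans (residual_cvg0 (i := i)); apply: cvg_app.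
have hP : entry_cvg U (fun n => y n - ys) (yi - ys).
  by apply: entry_cvgB => //; exact: entry_cvg_cst.
(* This is the right-hand side of [iterate_monotone], regrouped so that each inner product has a
   factor tending to 0. *)
have lim0 : dot (y n - ys - rho *: (A *m (x n.+1 - xs))) (A *m (x n.+1 - xs))
    + dot (M *m (x n - x n.+1) - rho *: (T *m (x n - x n.+1))) (x n.+1 - xs)
    @[n --> U] --> 0.
  have -> : 0 = dot (yi - ys - rho *: 0) 0 + dot (M *m 0 - rho *: (T *m 0)) e :> R.
    by rewrite dot0r !mulmx0 scaler0 subr0 dotC dot0r addr0.
  apply: cvgD; apply: cvg_dot => //.
    exact: entry_cvgB hP (entry_cvgZ rP).
  by apply: entry_cvgB; [exact: entry_cvg_mulmx|exact/entry_cvgZ/entry_cvg_mulmx].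
have lime : mu * dot (x n.+1 - xs) (x n.+1 - xs) @[n --> U] --> mu * dot e e.
  by apply: cvgM; [exact: cvg_cst|exact: cvg_dot].
have ee0 : mu * dot e e <= 0.
  apply: ler_cvg_to lime lim0 _; apply: nearW => n.
  have := iterate_monotone n.
  by rewrite -addrA (addrC (- _)) [X in _ <= X -> _]dotDl dot_mulmxl trmxK.
have e0 : e = 0.
  apply: dot_eq0; apply/eqP; rewrite eq_le dot_ge0 andbT.
  by rewrite -(pmulr_rle0 _ mu_gt0).
by rewrite -[xs]add0r -e0; exact: entry_cvg_subK.
Qed.

End AlongUltrafilter.

End AtKKTPoint.

Theorem iterates_cvg : (exists u, subdiff F u.1 (A^T *m u.2) /\ A *m u.1 = b) ->
  exists u, [/\ subdiff F u.1 (A^T *m u.2), A *m u.1 = b &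
    (fun n => (x n, y n)) @ \oo --> u].
Proof.
move=> [[xs ys] /= [sub_xs Axs]].
have [U [UU U_oo]] := @ultraFilterLemma nat \oo _.
have UP : ProperFilter U by exact: ultra_proper.
have [yi yiP] := dual_ultra_cvg sub_xs Axs (UU := UU).
have x1P := primal_ultra_cvg sub_xs Axs U_oo (UU := UU).
have dP : entry_cvg U (fun n => x n - x n.+1) 0.
  by move=> i; apply: cvg_trans (step_cvg0 sub_xs Axs (i := i)); apply: cvg_app.
have xP : entry_cvg U x xs.
  rewrite -[xs]add0r (_ : x = fun n => x n - x n.+1 + x n.+1).
    exact: entry_cvgD dP x1P.
  by apply/funext => n; rewrite subrK.
(* The subgradient inequality at [x n.+1] passes to the limit: [x n] and [x n.+1] both tend to [xs],
   which is feasible, so [s n] tends to [A^T *m yi]. *)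
have sub_yi : subdiff F xs (A^T *m yi).
  apply/(subdiffP F_gtNy); split; first exact: sub_xs.1.
  move=> w Fw.
  have sP : entry_cvg U s (A^T *m yi).
    have -> : A^T *m yi = A^T *m (yi - rho *: (A *m xs - b))
                          - rho *: (T *m 0) + M *m 0.
      by rewrite Axs subrr !mulmx0 !scaler0 !subr0 addr0.
    apply: entry_cvgD; last exact: entry_cvg_mulmx.
    apply: entry_cvgB; last exact/entry_cvgZ/entry_cvg_mulmx.
    apply/entry_cvg_mulmx/entry_cvgB => //; apply: entry_cvgZ.
    by apply: entry_cvgB; [exact: entry_cvg_mulmx|exact: entry_cvg_cst].
  (* Lower semicontinuity of [F] along the iterates comes for free from the
     subgradient at [xs]. *)
  have lim : fine (F xs) + dot (A^T *m ys) (x n.+1 - xs) + dot (s n) (w - x n.+1)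
      @[n --> U] --> fine (F xs) + dot (A^T *m ys) (xs - xs) + dot (A^T *m yi) (w - xs).
    apply: cvgD; [apply: cvgD; [exact: cvg_cst|]|]; apply: cvg_dot => //.
    - exact: entry_cvg_cst.
    - by apply: entry_cvgB => //; exact: entry_cvg_cst.
    - by apply: entry_cvgB => //; exact: entry_cvg_cst.
  rewrite subrr dot0r addr0 in lim.
  apply: (cvgr_to_le lim); apply: nearW => n.
  have [Fx1 Hx1] := (subdiffP F_gtNy _ _).1 (x_step n).
  have [_ Hxs] := (subdiffP F_gtNy _ _).1 sub_xs.
  by have := Hx1 w Fw; have := Hxs _ Fx1; lra.
exists (xs, yi); split=> //.
have V0 : V xs yi @ \oo --> (0 : R).
  have Vc := lyapunov_iterates_is_cvg sub_yi Axs.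
  suff -> : 0 = limn (V xs yi) by exact: Vc.
  (* The limit along [\oo] is also the limit along the finer [U], where its value can be
     computed. *)
  have VU : V xs yi @ U --> limn (V xs yi) by apply: cvg_trans Vc; exact: cvg_app.
  suff VU0 : V xs yi @ U --> (0 : R) by exact: (cvg_unique _ VU0 VU).
  have -> : 0 = 2^-1 * dot (xs - xs) (M *m (xs - xs))
      + (2 * (gamma * rho))^-1 * dot (yi - yi) (yi - yi) :> R.
    by rewrite !subrr mulmx0 !dot0r !mulr0 addr0.
  rewrite /V /lyapunov; under eq_cvg do rewrite sqnormE.
  have xsP : entry_cvg U (fun n => x n - xs) (xs - xs).
    by apply: entry_cvgB => //; exact: entry_cvg_cst.
  have ysP : entry_cvg U (fun n => y n - yi) (yi - yi).
    by apply: entry_cvgB => //; exact: entry_cvg_cst.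
  apply: cvgD; apply: cvgM; first exact: cvg_cst.
  - by apply: cvg_dot => //; exact: entry_cvg_mulmx.
  - exact: cvg_cst.
  - by apply: cvg_dot.
have [xc yc] := lyapunov_cvg0_iterates_cvg V0.
exact: cvg_pair (entry_cvg_cvg xc) (entry_cvg_cvg yc).
Qed.

End AbstractConvergence.

(** * Separable objectives *)

Section Optimality.
Context {R : realType} {k : nat}.
Variable f : 'cV[R]_k -> \bar R.
Hypotheses (f_gtNy : forall x, (-oo < f x)%E) (f_convex : convex_efun f).
Hypothesis f_proper : edom f !=set0.

(** Minimality of [z] is tested at points of the segment from [z] to [w]; convexity bounds [f]
    there, and dividing by [t] leaves an error [t * C] that can be made arbitrarily small. *)
Lemma argmin_subgradient (q : 'cV[R]_k -> R) (z g : 'cV[R]_k) :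
  is_argmin (fun w => (f w + (q w)%:E)%E) z ->
  (forall h, exists C, forall t, q (z + t *: h) = q z + t * dot g h + t ^+ 2 * C) ->
  subdiff f z (- g).
Proof.
move=> zmin qz; have [w0 fw0] := f_proper.
have fz : edom f z.
  have := zmin w0; rewrite -(edom_fineK f_gtNy fw0) -EFinD => H.
  have := le_lt_trans H (ltry _).
  by rewrite /edom /=; case: (f z) (f_gtNy z).
apply/(subdiffP f_gtNy); split=> // w fw.
have [C HC] := qz (w - z).
rewrite dotNl lerBlDr.
have key (t : R) : 0 < t <= 1 ->
    fine (f z) <= fine (f w) + dot g (w - z) + t * C.
  move=> /andP[t0 t1].
  have conv : (f (z + t *: (w - z)) <= t%:E * f w + (1 - t)%:E * f z)%E.
    have -> : z + t *: (w - z) = t *: w + (1 - t) *: z.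
      by rewrite scalerBr scalerBl scale1r addrC -addrA (addrC (- _)).
    by apply: f_convex; rewrite (ltW t0).
  have := le_trans (zmin (z + t *: (w - z))) (leeD conv (lexx (q (z + t *: (w - z)))%:E)).
  rewrite -(edom_fineK f_gtNy fw) -(edom_fineK f_gtNy fz) HC.
  rewrite -!EFinM -!EFinD lee_fin => H.
  rewrite -(ler_pM2l t0); lra.
apply/ler_addgt0Pr => e e0.
have [C0|C0] := lerP C 0.
  have := key 1; rewrite lexx ltr01 => /(_ isT); lra.
(* This [t] makes [t * C] at most [e] while staying on the segment; for [C <= 0] the choice [t = 1]
   was enough. *)
have tP : 0 < Num.min 1 (e / C) <= 1.
  by rewrite lt_min ltr01 divr_gt0 //= ge_min lexx.
apply: le_trans (key _ tP) _; rewrite lerD2l.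
by rewrite -ler_pdivlMr // ge_min lexx orbT.
Qed.

(** An exact Taylor formula, supplying the gradient and the constant required by
    [argmin_subgradient]; symmetry of [P] merges its two cross terms. *)
Lemma quadratic_expansion l (B : 'M[R]_(l, k)) (c : 'cV[R]_l) (P : 'M[R]_k)
    (x0 z h : 'cV[R]_k) (rho t : R) : P^T = P ->
  let q w := rho / 2 * norm2 (B *m w + c) ^+ 2 + 2^-1 * sqnorm P (w - x0) in
  q (z + t *: h) =
    q z + t * dot (rho *: (B^T *m (B *m z + c)) + P *m (z - x0)) h
    + t ^+ 2 * (rho / 2 * dot (B *m h) (B *m h) + 2^-1 * sqnorm P h).
Proof.
move=> Psym q; rewrite /q !sqr_norm2 !sqnormE.
have -> : B *m (z + t *: h) + c = (B *m z + c) + t *: (B *m h).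
  by rewrite mulmxDr -scalemxAr addrAC.
have -> : z + t *: h - x0 = (z - x0) + t *: h by rewrite addrAC.
move: (z - x0) (B *m z + c) => v u.
rewrite (mulmxDr P) -scalemxAr !(dotDl, dotDr, dotZl, dotZr).
rewrite (dot_mulmxl B^T) trmxK (dot_mulmxr P v h) Psym (dotC h (P *m v)) (dotC (B *m h) u).
by field.
Qed.

End Optimality.

Section Separable.
Context {R : realType} {n : nat} {N : 'I_n -> nat}.
Variable f : forall j, 'cV[R]_(N j) -> \bar R.
Arguments f : clear implicits.
Hypothesis f_gtNy : forall j x, (-oo < f j x)%E.
Implicit Types x w s : 'cV[R]_(\sum_j N j).

Lemma sep_fun_gtNy x : (-oo < sep_fun f x)%E.
Proof.
rewrite ltNye; apply/eqP => /esum_eqNyP [j [_ _ fj]].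
by have := f_gtNy (submxcol x j); rewrite fj.
Qed.

Lemma edom_sep_fun x : edom (sep_fun f) x <-> forall j, edom (f j) (submxcol x j).
Proof.
split=> [Fx j|fx]; last by apply: lte_sum_pinfty => j _; exact: fx.
rewrite /edom /= ltNge leye_eq; apply/negP => /eqP fj.
suff Foo : sep_fun f x = +oo%E by move: Fx; rewrite /edom /= Foo.
apply/esum_eqyP; first by move=> i _; rewrite -ltNye.
by exists j; split=> //; rewrite mem_index_enum.
Qed.

Lemma fine_sep_fun x : edom (sep_fun f) x ->
  fine (sep_fun f x) = \sum_j fine (f j (submxcol x j)).
Proof.
move=> /edom_sep_fun fx; rewrite /sep_fun -[RHS]/(fine (_)%:E) -sumEFin.
by congr fine; apply: eq_bigr => j _; rewrite edom_fineK.
Qed.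

(** From blocks to the sum, add the inequalities. Conversely, test with a point that differs from
    [x] only in block [j]: the other terms are finite and cancel. *)
Lemma subdiff_sep_fun x s : subdiff (sep_fun f) x s <->
  forall j, subdiff (f j) (submxcol x j) (submxcol s j).
Proof.
split=> [/(subdiffP sep_fun_gtNy) [Fx sub] j|sub]; last first.
  have Fx : edom (sep_fun f) x by apply/edom_sep_fun => j; exact: (sub j).1.
  apply/(subdiffP sep_fun_gtNy); split=> // w Fw.
  rewrite !fine_sep_fun // dot_mxcol -big_split /=; apply: ler_sum => j _.
  rewrite submxcolB; have [_] := (subdiffP (@f_gtNy j) _ _).1 (sub j).
  by apply; exact/(edom_sep_fun w).1.
have fx := (edom_sep_fun x).1 Fx.
apply/(subdiffP (@f_gtNy j)); split=> // v fv.
pose wv : forall i, 'cV[R]_(N i) := dfwith (fun i => submxcol x i) j v.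
have wj : wv j = v by rewrite /wv dfwithin.
have wi i : i != j -> wv i = submxcol x i.
  by move=> ij; rewrite /wv dfwithout // eq_sym.
have Fw : edom (sep_fun f) (\mxcol_i wv i).
  apply/edom_sep_fun => i; rewrite mxcolK.
  by have [->|/wi ->] := eqVneq i j; [rewrite wj|].
have := sub _ Fw; rewrite !fine_sep_fun // dot_mxcol (bigD1 j) //= (bigD1 j (P := predT)) //=.
rewrite [X in _ <= X](bigD1 j) //= !submxcolB !mxcolK wj.
rewrite [X in _ + _ + (_ + X)]big1 ?addr0; last first.
  by move=> i /wi wiE; rewrite submxcolB mxcolK wiE subrr dot0r.
rewrite addrAC.
have -> : \sum_(i < n | i != j) fine (f i (submxcol (\mxcol_i wv i) i)) =
          \sum_(i < n | i != j) fine (f i (submxcol x i)).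
  by apply: eq_bigr => i /wi wiE; rewrite mxcolK wiE.
by rewrite lerD2r.
Qed.

(** A subgradient of the sum splits into block subgradients, and each block modulus may be lowered
    to [mu] before summing. *)
Lemma strongly_convex_sep_fun (mu_ : 'I_n -> R) mu :
  (forall j, strongly_convex (f j) (mu_ j)) -> (forall j, mu <= mu_ j) ->
  strongly_convex (sep_fun f) mu.
Proof.
move=> sc mu_le x w s Fx Fw /subdiff_sep_fun sub.
rewrite sqr_norm2 -(edom_fineK sep_fun_gtNy Fx) -(edom_fineK sep_fun_gtNy Fw).
rewrite -!EFinD lee_fin !fine_sep_fun // !dot_mxcol mulr_sumr -!big_split /=.
apply: ler_sum => j _; rewrite !submxcolB.
have fw := (edom_sep_fun w).1 Fw j.
apply: le_trans (strongly_convex_le (@f_gtNy j) (sc j) fw (sub j)).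
by rewrite lerD2l ler_wpM2r ?dot_ge0 // ler_pM2r.
Qed.

(** The subgradient lies in the range of the transposed constraint matrix, hence is orthogonal to
    any difference of feasible points. *)
Lemma KKT_is_solution m (A : forall j, 'M[R]_(m, N j)) (b : 'cV[R]_m) u :
  KKT f A b u -> is_solution f A b u.1.
Proof.
move=> [sub Au]; split=> // w Aw.
have [Fw|] := pselect (edom (sep_fun f) w); last first.
  by rewrite /edom /= => /negP; rewrite -leNgt leye_eq => /eqP ->; rewrite leey.
have [Fx /(_ w Fw)] := (subdiffP sep_fun_gtNy _ _).1 sub.
rewrite dot_mulmxl trmxK mulmxBr Aw Au subrr dot0r addr0.
by rewrite -(edom_fineK sep_fun_gtNy Fx) -(edom_fineK sep_fun_gtNy Fw) lee_fin.
Qed.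

End Separable.

(** * Group matrices *)

Section BlockProducts.
Context {R : realType} {n : nat} {N : 'I_n -> nat}.
Implicit Types d : 'cV[R]_(\sum_j N j).

Lemma submxcol_mxdiag_mul (D : forall j, 'M[R]_(N j)) d j :
  submxcol (\mxdiag_j D j *m d) j = D j *m submxcol d j.
Proof. by rewrite -{1}(submxcolK d) mul_mxdiag_mxcol mxcolK. Qed.

Lemma submxcol_mxblock_mul (B : forall i j, 'M[R]_(N i, N j)) d j :
  submxcol (\mxblock_(i, j) B i j *m d) j = \sum_k B j k *m submxcol d k.
Proof. by rewrite -{1}(submxcolK d) mul_mxblock_mxrow mxcolK. Qed.

Lemma submxcolZ a d j : submxcol (a *: d) j = a *: submxcol d j.
Proof. by apply/colP => i; rewrite !mxE. Qed.

Lemma full_mx_mul m (A : forall j, 'M[R]_(m, N j)) d :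
  full_mx A *m d = \sum_k A k *m submxcol d k.
Proof. by rewrite /full_mx -{1}(submxcolK d) mul_mxrow_mxcol. Qed.

Lemma submxcol_tr_full_mx_mul m (A : forall j, 'M[R]_(m, N j)) (v : 'cV[R]_m) j :
  submxcol ((full_mx A)^T *m v) j = (A j)^T *m v.
Proof. by rewrite /full_mx tr_mxrow mxcol_mul mxcolK. Qed.

End BlockProducts.

Section Groups.
Context {R : realType} {n m l p : nat} {N : 'I_n -> nat}.
Variables (A : forall j, 'M[R]_(m, N j)) (P : forall j, 'M[R]_(N j)) (rho : R).
Hypotheses (n_eq : n = (l * p)%N) (p_gt0 : (0 < p)%N).
Hypothesis P_sym : forall j, (P j)^T = P j.
Implicit Types d : 'cV[R]_(\sum_j N j).

Lemma group_index_lt (j : 'I_n) : (j %/ p < l)%N.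
Proof. by rewrite ltn_divLR // -n_eq. Qed.

Definition group_index (j : 'I_n) : 'I_l := Ordinal (group_index_lt j).

Lemma big_group (V : nmodType) (Q : pred 'I_l) (E : 'I_n -> V) :
  \sum_(q < l | Q q) \sum_(k in block_group n p q) E k =
  \sum_(k | Q (group_index k)) E k.
Proof.
rewrite [RHS](partition_big group_index Q) //=.
apply: eq_bigr => q Qq; apply: eq_bigl => k; rewrite inE -val_eqE /=.
by case: eqP => [kq|]; rewrite ?andbT ?andbF // (_ : group_index k = q) //; apply: val_inj.
Qed.

(* The block diagonal matrix of the group matrices, on the whole of R^N. *)
Definition all_groups_mx : 'M[R]_(\sum_j N j) :=
  \mxdiag_j P j +
  \mxblock_(j, k) (if (j != k) && (j %/ p == k %/ p)%N
                   then - rho *: ((A j)^T *m A k) else 0).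

Lemma submxcol_all_groups_mx_mul d j : submxcol (all_groups_mx *m d) j =
  P j *m submxcol d j -
  rho *: ((A j)^T *m \sum_(k in block_group n p (j %/ p) | k != j)
            A k *m submxcol d k).
Proof.
rewrite mulmxDl submxcolD submxcol_mxdiag_mul submxcol_mxblock_mul.
congr (_ + _); rewrite mulmx_sumr scaler_sumr -sumrN big_mkcondr big_mkcond /=.
apply: eq_bigr => k _; rewrite inE.
have [_|_] := eqVneq k j; have [_|_] := eqVneq (k %/ p)%N (j %/ p)%N;
  rewrite /= ?mul0mx //.
by rewrite -scalemxAl scaleNr mulmxA.
Qed.

Lemma submxcol_upper_mx_mul d j : submxcol (upper_mx p A *m d) j =
  (A j)^T *m \sum_(k < n | (j %/ p < k %/ p)%N) A k *m submxcol d k.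
Proof.
rewrite submxcol_mxblock_mul mulmx_sumr [RHS]big_mkcond /=.
by apply: eq_bigr => k _; case: ltnP; rewrite ?mul0mx // mulmxA.
Qed.

Lemma all_groups_mx_sym : all_groups_mx^T = all_groups_mx.
Proof.
rewrite linearD /= tr_mxdiag tr_mxblock; congr (_ + _).
  by apply: eq_mxdiag => j; rewrite P_sym.
apply: eq_mxblock => j k; rewrite eq_sym (eq_sym (k %/ p)%N).
by case: ifP => _; rewrite ?trmx0 // linearZ /= trmx_mul trmxK.
Qed.

Definition group_restriction (i : nat) d : 'cV[R]_(\sum_q group_dim (p := p) N (i := i) q) :=
  \mxcol_q submxcol d (enum_val q).

Lemma dot_group_restriction d :
  dot d d = \sum_(i < l) dot (group_restriction i d) (group_restriction i d).
Proof.
rewrite dot_mxcol -(big_group xpredT); apply: eq_bigr => i _.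
rewrite dot_mxcol (big_enum_val (fun j => dot (submxcol d j) (submxcol d j))).
by apply: eq_bigr => q _; rewrite mxcolK.
Qed.

(** Blocks of different groups are not coupled in [all_groups_mx], so its quadratic form splits
    along the partition. *)
Lemma sqnorm_all_groups_mx d :
  sqnorm all_groups_mx d =
  \sum_(i < l) sqnorm (group_mx p A rho P i) (group_restriction i d).
Proof.
(* Both sides are expanded into the diagonal terms [G] and the couplings [E] inside a group. *)
pose E j k := if (j != k) then - rho * dot (A j *m submxcol d j) (A k *m submxcol d k) else 0.
pose G j := dot (submxcol d j) (P j *m submxcol d j).
have -> : sqnorm all_groups_mx d =
    \sum_j (G j + \sum_(k in block_group n p (j %/ p)) E j k).
  rewrite sqnormE dot_mxcol; apply: eq_bigr => j _.
  rewrite submxcol_all_groups_mx_mul dotDr dotNr dotZr -dot_mulmxl dot_sumr.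
  congr (_ + _); rewrite mulr_sumr -sumrN big_mkcondr /=; apply: eq_bigr => k _.
  by rewrite /E eq_sym; case: ifP; rewrite ?mulNr.
rewrite -(big_group xpredT); apply: eq_bigr => i _.
rewrite sqnormE dot_mxcol.
rewrite (big_enum_val (fun j => G j + \sum_(k in block_group n p (j %/ p)) E j k)).
apply: eq_bigr => q _.
rewrite /group_mx mulmxDl submxcolD submxcol_mxdiag_mul submxcol_mxblock_mul mxcolK.
rewrite dotDr; congr (_ + _).
have /eqP -> : (enum_val q %/ p == i)%N by have := enum_valP q; rewrite inE.
rewrite dot_sumr (big_enum_val (fun k => E (enum_val q) k)); apply: eq_bigr => r _.
rewrite mxcolK /E (inj_eq enum_val_inj); have [_|_] /= := eqVneq q r.
  by rewrite mul0mx dot0r.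
by rewrite -scalemxAl dotZr -mulmxA -dot_mulmxl.
Qed.

(** The form is a sum of nonnegative group forms; if it vanishes, so does every group restriction,
    and hence [z]. *)
Lemma all_groups_mx_posdef (c : R) :
  (forall i : 'I_l, posdef (group_mx p A rho P i - c%:M)) ->
  posdef (all_groups_mx - c%:M).
Proof.
move=> pd; split=> [|z z0]; first by rewrite linearB /= all_groups_mx_sym tr_scalar_mx.
have -> : sqnorm (all_groups_mx - c%:M) z =
    \sum_(i < l) sqnorm (group_mx p A rho P i - c%:M) (group_restriction i z).
  rewrite sqnormB sqnorm_scalar sqnorm_all_groups_mx dot_group_restriction.
  rewrite mulr_sumr -sumrB; apply: eq_bigr => i _.
  by rewrite sqnormB sqnorm_scalar.
have ge0 (i : 'I_l) : true ->
    0 <= sqnorm (group_mx p A rho P i - c%:M) (group_restriction i z).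
  by move=> _; exact: sqnorm_ge0.
rewrite lt_def sumr_ge0 // andbT; apply: contraNneq z0 => /eqP.
rewrite psumr_eq0 // => /allP z0.
apply/eqP/dot_eq0; rewrite dot_group_restriction big1 // => i _.
have [->|zi] := eqVneq (group_restriction i z) 0; first exact: dot0r.
have := z0 i (mem_index_enum _) => /= /eqP zi0.
by have := (pd i).2 _ zi; rewrite zi0 ltxx.
Qed.

(* Telescopes the Gauss-Seidel sweep: the residual seen by block [j] is the
   residual at the new point [x'] plus corrections for the blocks that are still
   at the old point [x] when block [j] is updated. *)
Lemma group_residual b (x x' : 'cV[R]_(\sum_j N j)) (i : 'I_l) j :
  j \in block_group n p i ->
  A j *m submxcol x' j + \sum_(k in block_group n p i | k != j) A k *m submxcol x k
    - group_rhs p A b i x x' =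
  full_mx A *m x' - b
  + \sum_(k < n | (j %/ p < k %/ p)%N) A k *m submxcol (x - x') k
  + \sum_(k in block_group n p (j %/ p) | k != j) A k *m submxcol (x - x') k.
Proof.
rewrite inE => /eqP ji; rewrite ji /group_rhs /group_mul.
rewrite (big_group (fun q => (q < i)%N)) (big_group (fun q => (i < q)%N)) /=.
rewrite full_mx_mul !opprB !addrA (addrAC _ (- b)) (addrAC _ (- b)); congr (_ - b).
have -> : A j *m submxcol x' j = \sum_(k < n | k == j) A k *m submxcol x' k.
  by rewrite big_pred1_eq.
(* Every conditional sum is extended by 0 to all blocks, so the identity can be checked block by
   block: first [k = j], then according to the order between the group of [k] and [i]. *)
rewrite [X in X + _ + _ + _ = _]big_mkcond [X in _ + X + _ + _ = _]big_mkcond.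
rewrite [X in _ + _ + X + _ = _]big_mkcond [X in _ + _ + _ + X = _]big_mkcond.
rewrite [X in _ = _ + X + _]big_mkcond [X in _ = _ + X]big_mkcond /=.
rewrite -!big_split /=; apply: eq_bigr => k _; rewrite inE submxcolB mulmxBr.
have [->|kj] := eqVneq k j.
  by rewrite ji eqxx !ltnn !addr0.
by case: ltngtP => _; rewrite ?add0r ?addr0 // addrC subrK.
Qed.

End Groups.

(** * H-ADMM as an instance of the abstract iteration *)

Theorem mainTheorem4 (R : realType) (n m l p : nat) (N : 'I_n -> nat)
    (f : forall j : 'I_n, 'cV[R]_(N j) -> \bar R)
    (A : forall j : 'I_n, 'M[R]_(m, N j)) (b : 'cV[R]_m)
    (P : forall j : 'I_n, 'M[R]_(N j))
    (mu_ : 'I_n -> R) (mu rho gamma : R)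
    (n_ge2 : (2 <= n)%N) (n_eq : n = (l * p)%N) (l_lt_n : (l < n)%N)
    (f_gtNy : forall j x, (-oo < f j x)%E)
    (f_convex : forall j, convex_efun (f j))
    (f_closed : forall j, closed_efun (f j))
    (KKT_nonempty : KKT f A b !=set0)
    (mu_gt0 : forall j, 0 < mu_ j)
    (f_strongly_convex : forall j, strongly_convex (f j) (mu_ j))
    (mu_min : (forall j, mu <= mu_ j) /\ (exists j, mu = mu_ j))
    (rho_gt0 : 0 < rho) (gamma_gt0 : 0 < gamma) (gamma_lt2 : gamma < 2)
    (P_sym : forall j, (P j)^T = P j)
    (P_large : forall i : 'I_l,
      posdef (group_mx p A rho P i
              - (rho ^+ 2 / (2 * mu) * spectral_norm (upper_mx p A) ^+ 2)%:M))
    (x : nat -> 'cV[R]_(\sum_j N j)) (y : nat -> 'cV[R]_m)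
    (xy_HADMM : HADMM l p f A b rho gamma P x y) :
  exists u : 'cV[R]_(\sum_j N j) * 'cV[R]_m,
    [/\ KKT f A b u, is_solution f A b u.1 &
        (fun k => (x k, y k)) @ \oo --> u].
Proof.
have p_gt0 : (0 < p)%N.
  by rewrite lt0n; apply/eqP => p0; move: n_ge2; rewrite n_eq p0 muln0.
have mu_pos : 0 < mu by have [_ [j ->]] := mu_min; exact: mu_gt0.
have [us us_KKT] := KKT_nonempty.
set sigma2 := spectral_norm (upper_mx p A) ^+ 2 in P_large.
have Q_posdef := all_groups_mx_posdef n_eq p_gt0 P_sym P_large.
(* Optimality of each block subproblem yields block [j] of the stacked subgradient required by
   [iterates_cvg]. *)
have iterate_subgradient k j : subdiff (f j) (submxcol (x k.+1) j)
    (submxcol ((full_mx A)^T *m (y k - rho *: (full_mx A *m x k.+1 - b))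
      - rho *: (upper_mx p A *m (x k - x k.+1))
      + all_groups_mx (p := p) A P rho *m (x k - x k.+1)) j).
  pose i := group_index n_eq p_gt0 j.
  have ji : j \in block_group n p i by rewrite inE.
  (* A KKT point lies in the domain of the sum, so each of its blocks lies in the domain of
     [f j]. *)
  have fj_proper : edom (f j) !=set0.
    exists (submxcol us.1 j); apply: (edom_sep_fun f_gtNy us.1).1.
    exact: us_KKT.1.1.
  have argmin := (xy_HADMM k).1 i j ji.
  (* The part of the residual that is independent of the block being minimized, including the dual
     shift. *)
  set c := \sum_(k0 in block_group n p i | k0 != j) A k0 *m submxcol (x k) k0
      - group_rhs p A b i (x k) (x k.+1) - rho^-1 *: y k.
  pose q w := rho / 2 * norm2 (A j *m w + c) ^+ 2 + 2^-1 * sqnorm (P j) (w - submxcol (x k) j).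
  have argmin' : is_argmin (fun w => (f j w + (q w)%:E)%E) (submxcol (x k.+1) j).
    move=> w; have := argmin w; rewrite /block_objective /q /c.
    by rewrite !addrA.
  set z := submxcol (x k.+1) j in argmin' *.
  pose g := rho *: ((A j)^T *m (A j *m z + c)) + P j *m (z - submxcol (x k) j).
  have : subdiff (f j) z (- g).
    apply: (argmin_subgradient (f_gtNy j) (f_convex j) fj_proper argmin') => h.
    exists (rho / 2 * dot (A j *m h) (A j *m h) + 2^-1 * sqnorm (P j) h) => t.
    exact: quadratic_expansion.
  congr (subdiff _ _ _).
  rewrite submxcolD submxcolB submxcol_tr_full_mx_mul submxcolZ.
  rewrite submxcol_upper_mx_mul submxcol_all_groups_mx_mul.
  rewrite /g /c !addrA (group_residual A n_eq p_gt0 b _ _ ji) -/z.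
  (* [U], from the later groups, gives the term in [upper_mx]; [W], from the same group, joins [P j]
     in [all_groups_mx]; [r] is the constraint residual at the new point. *)
  move: (\sum_(_ < _ | _) _) (\sum_(_ in _ | _) _) (_ - b) => U W r.
  rewrite submxcolB -/z -(opprB z) mulmxN !mulmxBr !mulmxDr -!scalemxAr.
  rewrite !scalerBr scalerA mulfV ?gt_eqF // scale1r.
  move: (_ *m r) (_ *m U) (_ *m W) (_ *m y k) (P j *m z) (P j *m _) => ar aU aW ay pz px.
  by apply/colP => t; rewrite !mxE; ring.
have [u [sub_u Au xy_cvg]] := iterates_cvg (sep_fun_gtNy f_gtNy)
  (strongly_convex_sep_fun f_gtNy f_strongly_convex mu_min.1)
  rho_gt0 gamma_gt0 gamma_lt2 mu_pos (sqr_ge0 _) (spectral_norm_bound (upper_mx p A))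
  Q_posdef (fun k => (subdiff_sep_fun f_gtNy _ _).2 (iterate_subgradient k))
  (fun k => (xy_HADMM k).2) (ex_intro _ us us_KKT).
have u_KKT : KKT f A b u by split.
by exists u; split=> //; apply: (KKT_is_solution f_gtNy).
Qed.
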